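(* Let $\delta\in\mathbb{C}$ and let $A$ be a symmetric $\delta$-Leibniz admissible algebra over $\mathbb{C}$. Then: (A) if $\delta\notin\{1,-1,\tfrac12\}$, then $A$ is a nilalgebra with nilindex $3$, i.e. $x^n=0$ for all $x\in A$ and all $n\geq 3$; (B) if $\delta=\tfrac12$, then $A$ is a power-associative algebra.
   Context: An algebra means a complex vector space with a bilinear multiplication, not assumed associative. For an algebra $A$ put $[x,y]_\delta=xy-\delta\,yx$. An algebra with product $\cdot$ is a symmetric $\delta$-Leibniz algebra if it satisfies both $(x\cdot y)\cdot z=\delta\big((x\cdot z)\cdot y+x\cdot(y\cdot z)\big)$ and $x\cdot(y\cdot z)=\delta\big((x\cdot y)\cdot z+y\cdot(x\cdot z)\big)$. The algebra $A$ is symmetric $\delta$-Leibniz admissible if the vector space $A$ with product $[\cdot,\cdot]_\delta$ is a symmetric $\delta$-Leibniz algebra. The assertion $x^n=0$ means that every product (in $A$) of $n$ copies of $x$, with any bracketing, is zero. An algebra is power-associative if the subalgebra generated by any single element is associative. *)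

(* Defs.v *)
From HB Require Import structures.
From mathcomp Require Import all_boot all_order all_algebra.
From mathcomp Require Import classical_sets.

Set Implicit Arguments.
Unset Strict Implicit.
Unset Printing Implicit Defensive.

Import GRing.Theory.
Local Open Scope ring_scope.

(* A nonassociative algebra over K is an lmodType A together with a bilinear
   product mul : {bilinear A -> A -> A}. *)

Definition delta_bracket (K : comNzRingType) (A : lmodType K) (delta : K)
    (mul : A -> A -> A) (x y : A) : A :=
  mul x y - delta *: mul y x.

Section DeltaBracketBilinear.
Variables (K : comNzRingType) (A : lmodType K) (delta : K).
Variable mul : {bilinear A -> A -> A}.

Lemma delta_bracket_bilinear :
  bilinear_for *:%R *:%R (delta_bracket delta mul).
Proof.
by split=> [y a u v|x a u v]; rewrite /delta_bracket linearPl linearPr /=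
  !(scalerDr, scalerN, scalerA) opprD addrACA [delta * a]mulrC.
Qed.

HB.instance Definition _ :=
  bilinear_isBilinear.Build K A A A *:%R *:%R (delta_bracket delta mul)
    delta_bracket_bilinear.

End DeltaBracketBilinear.

Definition symmetric_delta_Leibniz (K : comNzRingType) (A : lmodType K)
    (delta : K) (mul : {bilinear A -> A -> A}) : Prop :=
  (forall x y z : A,
     mul (mul x y) z = delta *: (mul (mul x z) y + mul x (mul y z))) /\
  (forall x y z : A,
     mul x (mul y z) = delta *: (mul (mul x y) z + mul y (mul x z))).

Definition symmetric_delta_Leibniz_admissible (K : comNzRingType)
    (A : lmodType K) (delta : K) (mul : {bilinear A -> A -> A}) : Prop :=
  symmetric_delta_Leibniz delta (delta_bracket delta mul).

(* [is_power mul x n y]: y is the product of n copies of x for some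
   bracketing; "x^n = 0" means that every such y is 0. *)
Inductive is_power (T : Type) (mul : T -> T -> T) (x : T) : nat -> T -> Prop :=
  | is_power1 : is_power mul x 1 x
  | is_powerM (m n : nat) (y z : T) :
      is_power mul x m y -> is_power mul x n z ->
      is_power mul x (m + n) (mul y z).

(* N bounds the nilindex from above: minimality of N is not required, so the
   zero algebra qualifies for every N. *)
Definition nilalgebra_of_nilindex (K : comNzRingType) (A : lmodType K)
    (mul : {bilinear A -> A -> A}) (N : nat) : Prop :=
  forall (x : A) (n : nat), (N <= n)%N ->
    forall y : A, is_power mul x n y -> y = 0.

Definition subalgebra (K : comNzRingType) (A : lmodType K)
    (mul : {bilinear A -> A -> A}) (B : set A) : Prop :=
  [/\ B 0,
      forall (a : K) (u v : A), B u -> B v -> B (a *: u + v) &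
      forall u v : A, B u -> B v -> B (mul u v)].

Definition generated_subalgebra (K : comNzRingType) (A : lmodType K)
    (mul : {bilinear A -> A -> A}) (G : set A) : set A :=
  smallest (subalgebra mul) G.

Definition power_associative (K : comNzRingType) (A : lmodType K)
    (mul : {bilinear A -> A -> A}) : Prop :=
  forall x u v w : A,
    generated_subalgebra mul [set x]%classic u ->
    generated_subalgebra mul [set x]%classic v ->
    generated_subalgebra mul [set x]%classic w ->
    mul (mul u v) w = mul u (mul v w).

(* Main.v *)
From HB Require Import structures.
Require Import Defs.
From mathcomp Require Import all_boot all_order all_algebra.
From mathcomp Require Import classical_sets.
From mathcomp Require Import reals complex.

(** Write [u . v] for the bracket [uv - delta vu], a symmetric delta-Leibniz
    product by assumption.  When [delta ^ 2 != 1] the original product can be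
    recovered from it; in particular, if [u . v = v . u], then [uv] is just
    [(1 - delta)^-1 (u . v)] ([mul_of_comm_bracket]).  So both claims reduce
    to the powers of one element for the bracket.

    With all arguments equal to [x], the two Leibniz identities have the same
    right-hand side, so [(x . x) . x = x . (x . x) = c] with [c = 2 delta c].

    If [2 delta != 1], then [c = 0], and one more use of the right identity
    gives [(x . x) . (x . x) = 0].  Hence [x^2 x], [x x^2] and [x^2 x^2] all
    vanish, and every bracketing of three or more factors contains one of
    these three products as a subproduct.

    If [delta = 1/2], let [p_n] be the right powers of [x] for the bracket,
    [p_(n+1) = p_n . x].  The right identity, applied to [(p_a . x) . p_c],
    presents a product of total degree [N] as the mean of [p_N] and
    [p_a . p_(c+1)], by induction on the degree.  So if one of the products
    [p_(a+1) . p_c] and [p_a . p_(c+1)] is [p_N], then so is the other, and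
    starting from [c = 1] all the products of degree [N] equal [p_N].  Hence
    bracket powers of [x] commute and add their exponents; up to powers of 2
    they are the powers of [x] for the original product, which therefore add
    their exponents too.  The subalgebra generated by [x] is then an image of
    the ring of polynomials without constant term ([power_associative_of_rpow]).
*)

Set Implicit Arguments.
Unset Strict Implicit.
Unset Printing Implicit Defensive.

Import GRing.Theory.
Local Open Scope ring_scope.

(** The right power [(..(x x) x ..) x] with [n.+1] factors: indices are
    shifted by one because there is no unit to serve as the power 0. *)
Definition rpow (T : Type) (mul : T -> T -> T) (x : T) (n : nat) : T :=
  iter n (mul^~ x) x.

Section PowerAssociativity.
Variables (K : comNzRingType) (A : lmodType K) (mul : {bilinear A -> A -> A}).
Variable x : A.

(** The value at [x] of the polynomial ['X * q], which makes sense without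
    a unit in [A]. *)
Definition rpow_eval (q : {poly K}) : A :=
  \sum_(i < size q) q`_i *: rpow mul x i.

Lemma rpow_evalE n (q : {poly K}) : (size q <= n)%N ->
  rpow_eval q = \sum_(i < n) q`_i *: rpow mul x i.
Proof.
move=> le_q_n; rewrite /rpow_eval (big_ord_widen n (fun i => q`_i *: rpow mul x i)) //.
rewrite big_mkcond; apply: eq_bigr => i _; case: ltnP => // le_q_i.
by rewrite nth_default // scale0r.
Qed.

Lemma rpow_eval_linear : linear rpow_eval.
Proof.
move=> a q r; pose n := maxn (size (a *: q + r)) (maxn (size q) (size r)).
have le_n s : s \in [:: a *: q + r; q; r] -> (size s <= n)%N.
  by rewrite !inE => /or3P[]/eqP->; rewrite !leq_max leqnn ?orbT.
rewrite !(@rpow_evalE n) ?le_n ?inE ?eqxx ?orbT // scaler_sumr -big_split /=.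
by apply: eq_bigr => i _; rewrite coefD coefZ scalerDl scalerA.
Qed.

HB.instance Definition _ :=
  GRing.isLinear.Build K {poly K} A *:%R rpow_eval rpow_eval_linear.

Lemma rpow_evalXn n : rpow_eval 'X^n = rpow mul x n.
Proof.
rewrite /rpow_eval size_polyXn big_ord_recr big1 /= => [|i _].
  by rewrite coefXn eqxx scale1r add0r.
by rewrite coefXn ltn_eqF ?ltn_ord // scale0r.
Qed.

Hypothesis rpowD :
  forall m n, mul (rpow mul x m) (rpow mul x n) = rpow mul x (m + n).+1.

Lemma rpow_evalM (q r : {poly K}) :
  mul (rpow_eval q) (rpow_eval r) = rpow_eval ('X * (q * r)).
Proof.
rewrite [in LHS]/rpow_eval -[in RHS](coefK q) -[in RHS](coefK r) !poly_def.
rewrite mulr_suml mulr_sumr linear_sumlz [RHS]linear_sum /=.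
apply: eq_bigr => i _; rewrite !mulr_sumr linear_sumr [RHS]linear_sum /=.
apply: eq_bigr => j _; rewrite linearZr_LR linearZl_LR /= rpowD.
rewrite -scalerAl -scalerAr -scalerAr -scalerAr !linearZ /=.
by rewrite -exprD -exprS rpow_evalXn !scalerA mulrC.
Qed.

(** Polynomial values form a subalgebra, on which associativity is inherited
    from polynomials. *)
Lemma generated_subalgebra_rpow_eval u :
  generated_subalgebra mul [set x]%classic u -> exists q, u = rpow_eval q.
Proof.
apply: (@smallest_sub _ _ _ [set v | exists q, v = rpow_eval q]%classic).
  split=> /=; first by exists 0; rewrite linear0.
    by move=> a _ _ [q ->] [r ->]; exists (a *: q + r); rewrite linearP.
  by move=> _ _ [q ->] [r ->]; exists ('X * (q * r)); rewrite rpow_evalM.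
by move=> _ ->; exists 1; rewrite -(expr0 'X) rpow_evalXn.
Qed.

End PowerAssociativity.

(** Polynomials [q], [r], [s] without the factor ['X] stand for three elements
    of the generated subalgebra; both bracketings of their product are the
    value of the same polynomial ['X * ('X * (q * r * s))]. *)
Lemma power_associative_of_rpow (K : comNzRingType) (A : lmodType K)
    (mul : {bilinear A -> A -> A}) :
  (forall x m n, mul (rpow mul x m) (rpow mul x n) = rpow mul x (m + n).+1) ->
  power_associative mul.
Proof.
move=> rpowD x u v w.
move=> /(generated_subalgebra_rpow_eval (rpowD x))[q ->].
move=> /(generated_subalgebra_rpow_eval (rpowD x))[r ->].
move=> /(generated_subalgebra_rpow_eval (rpowD x))[s ->].
rewrite !(rpow_evalM (rpowD x)); congr (rpow_eval _ _ ('X * _)).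
by rewrite -!mulrA mulrCA.
Qed.

(** The right identity, with [delta = 1/2] cleared of its denominator, says
    that [(p_a . x) . p_c] is the mean of the full power and
    [p_a . (x . p_c)]; this moves one factor at a time from left to right. *)
Lemma rpowD_half_Leibniz (K : comNzRingType) (A : lmodType K)
    (mul : {bilinear A -> A -> A}) (x : A) :
  (forall u v w : A,
     mul (mul u v) w *+ 2 = mul (mul u w) v + mul u (mul v w)) ->
  forall m n, mul (rpow mul x m) (rpow mul x n) = rpow mul x (m + n).+1.
Proof.
move=> Leib m n; have [N] := ubnP (m + n).
elim: N => // N IH_N in m n *; elim: n m => [|n IHn] m; first by rewrite addn0.
rewrite addnS ltnS => lt_mn_N.
have := Leib (rpow mul x m) x (rpow mul x n).
rewrite (IH_N m n) //.
have -> : mul x (rpow mul x n) = rpow mul x n.+1.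
  by rewrite (IH_N 0%N n) // (leq_ltn_trans _ lt_mn_N) // leq_addl.
rewrite -[mul (rpow mul x m) x]/(rpow mul x m.+1) IHn ?addSn //.
by rewrite -[mul _ x]/(rpow mul x (m + n).+2) mulr2n => /addrI.
Qed.

(** [c = (x . x) . x = x . (x . x)] because the two identities share their
    right-hand side, which reads [delta (c + c)]. *)
Lemma symmetric_Leibniz_cube (K : fieldType) (A : lmodType K) (delta : K)
    (mul : {bilinear A -> A -> A}) (x : A) :
  symmetric_delta_Leibniz delta mul -> delta != 2^-1 ->
  mul (mul x x) x = 0 /\ mul x (mul x x) = 0.
Proof.
move=> [Lr Ll] delta_half.
have eq_c : mul (mul x x) x = mul x (mul x x) by rewrite Lr -Ll.
suff c0 : mul x (mul x x) = 0 by rewrite eq_c.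
have /eqP := Ll x x x; rewrite eq_c -mulr2n -scaler_nat scalerA.
rewrite -subr_eq0 -[X in X - _]scale1r -scalerBl scaler_eq0 subr_eq0.
case/orP=> [/eqP eq1|/eqP //]; case/eqP: delta_half.
have nz2 : 2 != 0 :> K.
  by apply/eqP=> z2; move/eqP: eq1; rewrite z2 mulr0 oner_eq0.
by apply: (mulIf nz2); rewrite mulVf.
Qed.

(** In general [u . v + delta (v . u) = (1 - delta ^ 2) uv]; for commuting
    [u] and [v] the factor [1 + delta] cancels. *)
Lemma mul_of_comm_bracket (K : fieldType) (A : lmodType K) (delta : K)
    (mul : A -> A -> A) (u v : A) :
  delta != 1 -> delta != -1 ->
  delta_bracket delta mul u v = delta_bracket delta mul v u ->
  mul u v = (1 - delta)^-1 *: delta_bracket delta mul u v.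
Proof.
move=> delta1 deltaN1 comm.
have nz1 : 1 - delta != 0 by rewrite subr_eq0 eq_sym.
have nz2 : 1 + delta != 0 by rewrite addrC -[1]opprK subr_eq0.
apply: (scalerI nz1); rewrite scalerA mulfV // scale1r.
apply: (scalerI nz2); rewrite scalerA scalerDl scale1r [in X in _ = _ + X]comm.
rewrite /delta_bracket scalerBr scalerA addrA subrK.
by rewrite mulrC -subr_sqr expr1n expr2 scalerBl scale1r.
Qed.

Lemma nilalgebra3_admissible (K : fieldType) (A : lmodType K) (delta : K)
    (mul : {bilinear A -> A -> A}) :
  symmetric_delta_Leibniz_admissible delta mul ->
  delta \notin [:: 1; -1; 2^-1] -> nilalgebra_of_nilindex mul 3.
Proof.
move=> hA; rewrite !inE !negb_or => /and3P[d1 dN1 dh] x.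
pose b : {bilinear A -> A -> A} := delta_bracket delta mul.
have [bxx_x bx_xx] := symmetric_Leibniz_cube x hA dh.
have bxx_xx : b (b x x) (b x x) = 0.
  by rewrite /b hA.1 bx_xx linear0l linear0r addr0 scaler0.
have sq : mul x x = (1 - delta)^-1 *: b x x by apply: mul_of_comm_bracket.
have bsq_x : b (mul x x) x = 0 by rewrite sq linearZl_LR bxx_x scaler0.
have bx_sq : b x (mul x x) = 0 by rewrite sq linearZr_LR bx_xx scaler0.
have bsq_sq : b (mul x x) (mul x x) = 0.
  by rewrite sq linearZl_LR linearZr_LR bxx_xx !scaler0.
have mul0 u v : b u v = 0 -> b v u = 0 -> mul u v = 0.
  move=> buv bvu; have -> := mul_of_comm_bracket d1 dN1 (etrans buv (esym bvu)).
  by rewrite [delta_bracket _ _ _ _]buv scaler0.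
have pow_small n y : is_power mul x n y ->
    [\/ n = 1%N /\ y = x, n = 2 /\ y = mul x x | y = 0].
  elim=> {n y} [|m n y z _ IHy _ IHz]; first by apply: Or31.
  case: IHy => [[-> ->]|[-> ->]|->]; last by apply: Or33; rewrite linear0l.
    case: IHz => [[-> ->]|[-> ->]|->]; last by apply: Or33; rewrite linear0r.
      by apply: Or32.
    by apply: Or33; apply: mul0.
  case: IHz => [[-> ->]|[-> ->]|->]; last by apply: Or33; rewrite linear0r.
    by apply: Or33; apply: mul0.
  by apply: Or33; apply: mul0.
by move=> n le3n y /pow_small[[n_eq]|[n_eq]|//]; rewrite n_eq in le3n.
Qed.

Lemma power_associative_half_admissible (K : fieldType) (A : lmodType K)
    (mul : {bilinear A -> A -> A}) :
  2 != 0 :> K -> 3 != 0 :> K ->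
  symmetric_delta_Leibniz_admissible 2^-1 mul -> power_associative mul.
Proof.
move=> nz2 nz3 hA; apply: power_associative_of_rpow => x.
pose b : {bilinear A -> A -> A} := delta_bracket 2^-1 mul.
have bD : forall m n, b (rpow b x m) (rpow b x n) = rpow b x (m + n).+1.
  apply: rpowD_half_Leibniz => u v w.
  by rewrite /b hA.1 -scaler_nat scalerA mulfV // scale1r.
have half : 1 - 2^-1 = 2^-1 :> K.
  by apply: (mulIf nz2); rewrite mulrBl mulVf // mul1r -addrA subrr addr0.
have h1 : 2^-1 != 1 :> K.
  by rewrite -subr_eq0 -oppr_eq0 opprB half invr_eq0.
(* [1/2 = -1] would make [3] vanish. *)
have hN1 : 2^-1 != -1 :> K.
  apply: contra_neq nz3 => hN1; have := mulVf nz2; rewrite hN1 mulN1r => eq2.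
  by rewrite -natr1 -[X in _ + X]eq2 subrr.
have mulE m n : mul (rpow b x m) (rpow b x n) = 2 *: rpow b x (m + n).+1.
  rewrite (mul_of_comm_bracket h1 hN1) ?half ?invrK.
    by rewrite -[delta_bracket _ _ _ _]/(b _ _) bD.
  by rewrite -[LHS]/(b _ _) -[RHS]/(b _ _) !bD addnC.
have powE n : rpow mul x n = 2 ^+ n *: rpow b x n.
  elim: n => [|n IHn]; first by rewrite expr0 scale1r.
  rewrite -[LHS]/(mul (rpow mul x n) x) IHn linearZl_LR.
  by rewrite -[x in mul _ x]/(rpow b x 0) mulE addn0 scalerA -exprSr.
by move=> m n; rewrite !powE linearZl_LR linearZr_LR mulE !scalerA -exprD -exprSr.
Qed.

Theorem theorem51 (R : realType) (delta : R[i]) (A : lmodType R[i])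
    (mul : {bilinear A -> A -> A})
    (hA : symmetric_delta_Leibniz_admissible delta mul) :
  (delta \notin [:: 1; -1; 2^-1] -> nilalgebra_of_nilindex mul 3) /\
  (delta = 2^-1 -> power_associative mul).
Proof.
split; first exact: nilalgebra3_admissible hA.
move=> delta_half; rewrite delta_half in hA.
by apply: power_associative_half_admissible hA; rewrite Num.Theory.pnatr_eq0.
Qed.
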